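(* Let $\mathbf{A}$ be a random closed set in $\mathbb{R}^d$ with $\partial\mathbf{A}\neq\emptyset$ almost surely and $E|b_{\mathbf{A}}(x_0)|<\infty$ for some $x_0$. Then the expected set and the expected boundary are equivariant in the following sense. (1) (Homothecy) For every fixed scalar $\alpha\neq 0$, $$E[\alpha\mathbf{A}] = \alpha E[\mathbf{A}] \quad\text{and}\quad E[\partial(\alpha\mathbf{A})] = \alpha E[\partial\mathbf{A}].$$ (2) (Rigid motions) For every rigid motion $\mathrm{g}:\mathbb{R}^d\to\mathbb{R}^d$, $\mathrm{g}(x) = \Gamma x + a$ with $\Gamma\in O(d)$ an orthogonal matrix and $a\in\mathbb{R}^d$, $$E[\mathrm{g}\mathbf{A}] = \mathrm{g}E[\mathbf{A}] \quad\text{and}\quad E[\partial (\mathrm{g}\mathbf{A})] = \mathrm{g}E[\partial\mathbf{A}].$$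
   Context: Let $(\Omega, \mathscr{A}, \mathbf{P})$ be a probability space and $\mathcal{F}$ the family of closed subsets of $\mathbb{R}^d$. A random closed set is a map $\mathbf{A}:\Omega\to\mathcal{F}$ such that $\{\omega : \mathbf{A}(\omega)\cap K \neq \emptyset\} \in \mathscr{A}$ for every compact $K\subset\mathbb{R}^d$. For a nonempty set $A\subset\mathbb{R}^d$ let $d_A(x)=\inf_{y\in A}|x-y|$ (Euclidean norm). For a set $A\subset\mathbb{R}^d$ with $\partial A\ne\emptyset$, the oriented distance function (ODF) is $b_A(x) = d_A(x) - d_{A^c}(x)$, $x\in\mathbb{R}^d$; it is $1$-Lipschitz in $x$. For a random closed set $\mathbf{A}$ with $\partial\mathbf{A}\neq\emptyset$ a.s. and $E|b_{\mathbf{A}}(x_0)|<\infty$ for some $x_0$ (equivalently for all $x_0\in\mathbb{R}^d$), the expected set and expected boundary are $$E[\mathbf{A}] = \{x\in\mathbb{R}^d : E[b_{\mathbf{A}}(x)] \le 0\}, \qquad E[\partial\mathbf{A}] = \{x\in\mathbb{R}^d : E[b_{\mathbf{A}}(x)] = 0\}.$$ Here $E[\partial \mathbf{A}]$ is a single piece of notation determined by $\mathbf{A}$ (it is not the expected set of the random closed set $\partial\mathbf{A}$). For a set $S\subset\mathbb{R}^d$, $\alpha S = \{\alpha x : x\in S\}$ and $\mathrm{g}S = \{\mathrm{g}(x) : x\in S\}$. *)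

(* Defs.v *)
From HB Require Import structures.
From mathcomp Require Import all_boot all_order all_algebra.
From mathcomp Require Import all_classical all_reals all_analysis.
Set Implicit Arguments.
Unset Strict Implicit.
Unset Printing Implicit Defensive.
Import Order.TTheory GRing.Theory Num.Theory.
Import numFieldNormedType.Exports.
Local Open Scope classical_set_scope.
Local Open Scope ring_scope.

(* R^n is 'cV[R]_n.  The library norm on matrices is the sup norm, so the
   Euclidean norm is defined here; both induce the library topology. *)
Definition enorm (R : realType) (n : nat) (x : 'cV[R]_n) : R :=
  Num.sqrt (\sum_(i < n) x i 0 ^+ 2).

(* Only meaningful for A nonempty: inf set0 = 0. *)
Definition distance (R : realType) (n : nat) (A : set 'cV[R]_n)
    (x : 'cV[R]_n) : R :=
  inf [set enorm (x - y) | y in A].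

Definition boundary (R : realType) (n : nat) (A : set 'cV[R]_n) :
    set 'cV[R]_n :=
  closure A `&` closure (~` A).

(* Only meaningful when boundary A is nonempty, in which case neither A nor its
   complement is empty. *)
Definition odf (R : realType) (n : nat) (A : set 'cV[R]_n) (x : 'cV[R]_n) : R :=
  distance A x - distance (~` A) x.

Definition random_closed_set (disp : measure_display)
    (Omega : measurableType disp) (R : realType) (n : nat)
    (A : Omega -> set 'cV[R]_n) : Prop :=
  (forall w, closed (A w)) /\
  (forall K : set 'cV[R]_n, compact K ->
     measurable [set w | A w `&` K !=set0]).

(* The conditions under which the expected set and the expected boundary of A
   are defined. *)
Definition has_expected_set (disp : measure_display)
    (Omega : measurableType disp) (R : realType) (P : probability Omega R)
    (n : nat) (A : Omega -> set 'cV[R]_n) : Prop :=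
  [/\ random_closed_set A,
      {ae P, forall w, boundary (A w) !=set0}
    & exists x0 : 'cV[R]_n, ('E_P[fun w => `|odf (A w) x0|%R] < +oo)%E].

Definition expected_set (disp : measure_display)
    (Omega : measurableType disp) (R : realType) (P : probability Omega R)
    (n : nat) (A : Omega -> set 'cV[R]_n) : set 'cV[R]_n :=
  [set x | ('E_P[fun w => odf (A w) x] <= 0)%E].

(* A function of A itself: not the expected set of w |-> boundary (A w). *)
Definition expected_boundary (disp : measure_display)
    (Omega : measurableType disp) (R : realType) (P : probability Omega R)
    (n : nat) (A : Omega -> set 'cV[R]_n) : set 'cV[R]_n :=
  [set x | ('E_P[fun w => odf (A w) x] = 0)%E].

Definition homothecy (R : realType) (n : nat) (alpha : R) (x : 'cV[R]_n) :
    'cV[R]_n :=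
  alpha *: x.

Definition orthogonal_mx (R : realType) (n : nat) (Gamma : 'M[R]_n) : Prop :=
  Gamma^T *m Gamma = 1%:M.

Definition rigid_motion (R : realType) (n : nat) (g : 'cV[R]_n -> 'cV[R]_n) :
    Prop :=
  exists (Gamma : 'M[R]_n) (a : 'cV[R]_n),
    orthogonal_mx Gamma /\ forall x, g x = Gamma *m x + a.

(* Main.v *)
(* Homothecies and rigid motions are similarities: affine maps g x = M x + a
   with M^T M = c^2 for some c > 0 (c = |alpha|, resp. c = 1).  A similarity
   multiplies Euclidean distances by c and commutes with complements, so
   odf (g A) (g x) = c * odf A x; taking expectations preserves the sign. *)
Require Import Defs.
From mathcomp Require Import all_boot all_order all_algebra.
From mathcomp Require Import all_classical all_reals all_analysis.
Import Order.TTheory GRing.Theory Num.Theory.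
Import numFieldNormedType.Exports.
Local Open Scope classical_set_scope.
Local Open Scope ring_scope.

Lemma inf_pZl (R : realType) (X : set R) (r : R) : 0 < r -> has_lbound X ->
  inf [set r * x | x in X] = r * inf X.
Proof.
(* For empty [X] both sides are the default value [0]; hence the scaling of [distance], and then of
   [odf], holds for every set and at every [w]. *)
move=> r0 Xlb; have [->|X0] := eqVneq X set0.
  by rewrite image_set0 inf0 mulr0.
have {}X0 : X !=set0 by apply/set0P.
have rXlb : lbound [set r * x | x in X] (r * inf X).
  by move=> _ [x Xx <-]; rewrite ler_pM2l//; exact: ge_inf.
apply/eqP; rewrite eq_le; apply/andP; split; last first.
  by apply: lb_le_inf => //; case: X0 => x Xx; exists (r * x), x.
rewrite -ler_pdivrMl//; apply: lb_le_inf => // x Xx.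
rewrite ler_pdivrMl//; apply: ge_inf; first by exists (r * inf X).
by exists x.
Qed.

(** Preimages commute with complements and inherit closedness under continuity, so images under a
    bijection are handled in this form. *)
Lemma can2_image_preimage {T U : Type} {g : T -> U} {h : U -> T} (A : set T) :
  cancel g h -> cancel h g -> g @` A = h @^-1` A.
Proof.
move=> gK hK; rewrite eqEsubset; split=> [_ [x Ax <-]|y Ahy].
  by rewrite /preimage /= gK.
by exists (h y).
Qed.

Lemma image_closure_subset (T U : topologicalType) (g : T -> U) (A : set T) :
  continuous g -> g @` closure A `<=` closure (g @` A).
Proof.
move=> cg _ [x clAx <-] B /cg /clAx [y [Ay By]].
by exists (g y); split => //; exists y.
Qed.

(** Expanding in the matrices [delta_mx i j] reduces the claim to continuity of the coordinates. *)
Lemma mulmx_continuous (R : realType) (m n p : nat) (M : 'M[R]_(m, n)) :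
  continuous (fun x : 'M[R]_(n, p) => M *m x).
Proof.
have -> : (fun x : 'M[R]_(n, p) => M *m x) = (fun x =>
    \sum_i \sum_j \sum_k (M i k * x k j) *: delta_mx i j).
  apply/funext => x; rewrite [LHS]matrix_sum_delta.
  by do 2!apply: eq_bigr => ? _; rewrite mxE scaler_suml.
do 3!apply: (continuous_big (@add_continuous 'M[R]_(m, p))) => ? _.
move=> x; apply: (@cvgZr_tmp _ _ _ (nbhs x)).
by apply: (@cvgMl_tmp _ _ (nbhs x)); exact: coord_continuous.
Qed.

Section expectation_scaling.
Context (d : measure_display) (T : measurableType d) (R : realType).
Local Open Scope ereal_scope.
Import HBNNSimple.

(** The supremum from which [integral] is built, applied there to the positive and negative parts;
    named here so that it can be folded. *)
Let nnintegral (mu : {measure set T -> \bar R}) (f : T -> \bar R) :=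
  ereal_sup [set sintegral mu h |
    h in [set h : {nnsfun T >-> R} | forall x, (h x)%:E <= f x]].

(** Scaling by [r] maps the simple functions below [f] onto those below [r * f], with scaling by
    [r^-1] as inverse. *)
Let nnintegral_pZl (mu : {measure set T -> \bar R}) (f : T -> \bar R) (r : R) :
  (0 < r)%R -> nnintegral mu (fun x => r%:E * f x) = r%:E * nnintegral mu f.
Proof.
move=> r0; rewrite /nnintegral -ereal_sup_pZl//; congr ereal_sup.
rewrite eqEsubset; split=> [_ [h hf <-]|_ [_ [h hf <-] <-]].
  have ri0 : (0 <= r^-1)%R by rewrite invr_ge0 ltW.
  exists (sintegral mu (scale_nnsfun h ri0)).
    exists (scale_nnsfun h ri0) => // x /=.
    by rewrite EFinM lee_pdivrMl.
  by rewrite sintegralrM muleA -EFinM divff ?mul1e// gt_eqF.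
exists (scale_nnsfun h (ltW r0)); last by rewrite sintegralrM.
by move=> x /=; rewrite EFinM lee_pmul2l.
Qed.

(* f need not be measurable, unlike in the library's integralZl: the integral is
   a difference of suprema over simple functions, each of which scales. *)
Lemma integral_pZl (mu : {measure set T -> \bar R}) (f : T -> \bar R) (r : R) :
  (0 < r)%R -> \int[mu]_x (r%:E * f x) = r%:E * \int[mu]_x f x.
Proof.
move=> r0; rewrite /integral !patch_setT.
rewrite ge0_funeposM ?ltW// ge0_funenegM ?ltW//.
rewrite -/(nnintegral mu _) -/(nnintegral mu (fun x => r%:E * f^\- x)).
rewrite -/(nnintegral mu f^\+) -/(nnintegral mu f^\-).
rewrite !nnintegral_pZl//.
move: (nnintegral mu f^\+) (nnintegral mu f^\-) => a b.
(* Either part may be infinite; [+oo - +oo] is [-oo] by convention, and a positive factor preserves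
   this. *)
by case: a b => [a| |] [b| |]; rewrite /= ?(gt0_muley, gt0_muleNy) ?lte_fin//=
  -?EFinM -?EFinB ?mulrBr.
Qed.

Lemma expectation_pZl (P : probability T R) (X : T -> R) (r : R) :
  (0 < r)%R -> 'E_P[fun w => (r * X w)%R] = r%:E * 'E_P[X].
Proof.
by move=> r0; rewrite unlock -integral_pZl.
Qed.

End expectation_scaling.

Section similarity.
Context (R : realType) (n : nat) (c : R) (g h : 'cV[R]_n -> 'cV[R]_n).
Context (c0 : 0 < c) (gK : cancel g h) (hK : cancel h g).
Context (gc : continuous g) (hc : continuous h).
Context (gE : forall x y, enorm (g x - g y) = c * enorm (x - y)).
Implicit Types A : set 'cV[R]_n.

Lemma distance_similarity A x : distance (g @` A) (g x) = c * distance A x.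
Proof.
rewrite /distance -inf_pZl//; last by exists 0 => _ [y _ <-]; exact: sqrtr_ge0.
by rewrite !image_comp; congr inf; apply: eq_imagel => y _ /=.
Qed.

Let image_similarityC A : ~` (g @` A) = g @` (~` A).
Proof. by rewrite !(can2_image_preimage _ gK hK) preimage_setC. Qed.

Lemma odf_similarity A x : odf (g @` A) (g x) = c * odf A x.
Proof.
by rewrite /odf image_similarityC !distance_similarity mulrBr.
Qed.

(** This inclusion carries nonemptiness of the boundary over to the image. *)
Lemma boundary_similarity A : g @` boundary A `<=` boundary (g @` A).
Proof.
rewrite /boundary image_similarityC => _ [x [clA clCA] <-].
by split; apply: image_closure_subset => //; exists x.
Qed.

Context (disp : measure_display) (Omega : measurableType disp).

(** The image [g A] meets [K] exactly when [A] meets [h K], which is compact because [h] is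
    continuous. *)
Lemma random_closed_set_similarity (A : Omega -> set 'cV[R]_n) :
  random_closed_set A -> random_closed_set (fun w => g @` A w).
Proof.
move=> [Acl Ahit]; split=> [w|K cK].
  rewrite (can2_image_preimage _ gK hK).
  by apply: preimage_closed => // x _; exact: hc.
have -> : [set w | (g @` A w) `&` K !=set0] = [set w | A w `&` h @` K !=set0].
  apply/seteqP; split=> w [x].
    by case=> -[y Ay <-] Ky; exists y; split=> //; exists (g y).
  by case=> Ax [y Ky yx]; exists y; split=> //; exists x => //; rewrite -yx.
by apply: Ahit; apply: continuous_compact => //; exact: continuous_subspaceT.
Qed.

Context (P : probability Omega R).

Lemma expected_set_similarity (A : Omega -> set 'cV[R]_n) :
  has_expected_set P A ->
  [/\ has_expected_set P (fun w => g @` A w),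
      expected_set P (fun w => g @` A w) = g @` expected_set P A
    & expected_boundary P (fun w => g @` A w) = g @` expected_boundary P A].
Proof.
move=> [Acl bA [x0 x0fin]].
(* Every [x] equals [g (h x)], so the scaling identity can be read at an arbitrary point, matching
   the images written as preimages under [h]. *)
have EodfE x : ('E_P[fun w => odf (g @` A w) x] =
    c%:E * 'E_P[fun w => odf (A w) (h x)])%E.
  rewrite -expectation_pZl//; congr expectation; apply/funext => w.
  by rewrite -odf_similarity hK.
split.
- split; first exact: random_closed_set_similarity.
    apply: filterS bA => w [x bx]; exists (g x).
    by apply: boundary_similarity; exists x.
  exists (g x0).
  have -> : (fun w => `|odf (g @` A w) (g x0)|) = fun w => c * `|odf (A w) x0|.
    by apply/funext => w; rewrite odf_similarity normrM (gtr0_norm c0).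
  by rewrite expectation_pZl// lte_mul_pinfty// lee_fin ltW.
- rewrite (can2_image_preimage _ gK hK); apply/funext => x.
  by rewrite /expected_set /preimage /= EodfE pmule_rle0// lte_fin.
- rewrite (can2_image_preimage _ gK hK); apply/funext => x.
  rewrite /expected_boundary /preimage /= EodfE.
  apply/propext; split=> [/eqP|->].
    by rewrite mule_eq0 eqe gt_eqF//= => /eqP.
  by rewrite mule0.
Qed.

End similarity.

(** The squared norm of [M x] is [x^T (M^T M) x], that is [c^2] times [x^T x]. *)
Lemma enorm_mulmx (R : realType) (n : nat) (c : R) (M : 'M[R]_n)
    (x : 'cV[R]_n) : 0 <= c -> M^T *m M = (c ^+ 2)%:M ->
  enorm (M *m x) = c * enorm x.
Proof.
move=> c0 MM; have enormE (y : 'cV[R]_n) : enorm y = Num.sqrt ((y^T *m y) 0 0).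
  by rewrite mxE; congr Num.sqrt; apply: eq_bigr => i _; rewrite mxE expr2.
rewrite !enormE trmx_mul mulmxA -(mulmxA x^T) MM mul_mx_scalar -scalemxAl mxE.
by rewrite sqrtrM ?sqr_ge0// sqrtr_sqr ger0_norm.
Qed.

Lemma expected_set_affine (disp : measure_display)
    (Omega : measurableType disp) (R : realType) (P : probability Omega R)
    (n : nat) (A : Omega -> set 'cV[R]_n) (c : R) (M : 'M[R]_n) (a : 'cV[R]_n)
    (g := fun x => M *m x + a) :
  0 < c -> M^T *m M = (c ^+ 2)%:M -> has_expected_set P A ->
  [/\ has_expected_set P (fun w => g @` A w),
      expected_set P (fun w => g @` A w) = g @` expected_set P A
    & expected_boundary P (fun w => g @` A w) = g @` expected_boundary P A].
Proof.
(* The hypothesis on [M] makes [N] a left inverse; as [M] is square it is also a right inverse, so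
   [g] has the inverse [y |-> N (y - a)]. *)
move=> c0 MM; pose N := c ^- 2 *: M^T.
have NM : N *m M = 1%:M.
  by rewrite -scalemxAl MM scale_scalar_mx mulVf// expf_neq0// gt_eqF.
have MN := mulmx1C NM.
apply: (@expected_set_similarity _ _ c g (fun y => N *m (y - a))) => //.
- by move=> x; rewrite /g addrK mulmxA NM mul1mx.
- by move=> y; rewrite /g mulmxA MN mul1mx subrK.
- move=> x; apply: (@cvgD _ _ _ (nbhs x)); last exact: cvg_cst.
  exact: mulmx_continuous.
- move=> x; apply: (@continuous_comp 'cV[R]_n 'cV[R]_n 'cV[R]_n (fun y => y - a)
    (fun y => N *m y)).
    by apply: (@cvgB _ _ _ (nbhs x)); [exact: cvg_id|exact: cvg_cst].
  exact: mulmx_continuous.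
- move=> x y; rewrite /g opprD addrACA subrr addr0 -mulmxBr.
  by rewrite (enorm_mulmx _ _ c)// ltW.
Qed.

Theorem theorem3p2 (disp : measure_display) (Omega : measurableType disp)
    (R : realType) (P : probability Omega R) (n : nat)
    (A : Omega -> set 'cV[R]_n) (hA : has_expected_set P A) :
  (forall alpha : R, alpha != 0 ->
     [/\ has_expected_set P (fun w => homothecy alpha @` A w),
         expected_set P (fun w => homothecy alpha @` A w)
           = homothecy alpha @` expected_set P A
       & expected_boundary P (fun w => homothecy alpha @` A w)
           = homothecy alpha @` expected_boundary P A]) /\
  (forall g : 'cV[R]_n -> 'cV[R]_n, rigid_motion g ->
     [/\ has_expected_set P (fun w => g @` A w),
         expected_set P (fun w => g @` A w) = g @` expected_set P A
       & expected_boundary P (fun w => g @` A w)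
           = g @` expected_boundary P A]).
Proof.
split=> [alpha alpha0|g [Gamma [a [orthGamma gE]]]].
  (* A homothecy has the scalar matrix [alpha] and no translation. Its ratio is [|alpha|], since
     [alpha] may be negative. *)
  have homE : @homothecy R n alpha = fun x => alpha%:M *m x + 0.
    by apply/funext => x; rewrite addr0 mul_scalar_mx.
  rewrite homE; apply: (@expected_set_affine _ _ _ _ _ _ `|alpha|) => //.
    by rewrite normr_gt0.
  by rewrite tr_scalar_mx -scalar_mxM -expr2 real_normK ?num_real.
have -> : g = fun x => Gamma *m x + a by apply/funext.
by apply: (@expected_set_affine _ _ _ _ _ _ 1) => //; rewrite expr1n.
Qed.
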